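(* Let $P_b$ be a $(K,f,Z,\mathcal{S}_b)$ PDA. Let $\mathcal{P}=\{P_i: i\in\mathcal{S}_b\}$, where each $P_i$ is an $(m,n,e,\mathcal{S}_i)$ PDA and $\mathcal{S}_i,\mathcal{S}_j$ are disjoint whenever $i\ne j$. Let $B_{\mathcal{P}}(P_b)$ be the array obtained from $P_b$ by replacing each $\ast$ by the $n\times m$ all-$\ast$ array and replacing each occurrence of an integer $i\in\mathcal{S}_b$ by $P_i$. Then $B_{\mathcal{P}}(P_b)$ is a $(Km,\,fn,\,Zn+(f-Z)e,\,\mathcal{S})$ PDA, where $\mathcal{S}=\bigcup_{i\in\mathcal{S}_b}\mathcal{S}_i$.
   Context: Notation: $[n]=\{0,1,\dots,n-1\}$. For positive integers $K,f$, a nonnegative integer $Z$ and a finite set $\mathcal{S}$ of integers, a $(K,f,Z,\mathcal{S})$ placement delivery array (PDA) is an $f\times K$ array $P=[p_{j,k}]$ ($f$ rows, $K$ columns), $j\in[f]$, $k\in[K]$, with entries in $\mathcal{S}\cup\{\ast\}$ such that: (C1) $\ast$ appears exactly $Z$ times in each column; (C2) each $s\in\mathcal{S}$ occurs at least once; (C3, Blackburn property) if two distinct cells $(j_1,k_1)$, $(j_2,k_2)$ contain the same integer then $p_{j_1,k_2}=p_{j_2,k_1}=\ast$. *)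

(* Defs.v *)
From mathcomp Require Import all_boot all_order all_algebra.
From mathcomp Require Import finmap.

Set Implicit Arguments.
Unset Strict Implicit.
Unset Printing Implicit Defensive.

(* An array with [f] rows and [K] columns whose cells hold an integer
   ([Some s]) or the symbol * ([None]). *)
Definition pda_array (f K : nat) : Type := 'M[option int]_(f, K).

Definition is_PDA (K f Z : nat) (S : {fset int}) (P : pda_array f K) : Prop :=
  [/\ (0 < K)%N /\ (0 < f)%N,
      forall (j : 'I_f) (k : 'I_K) (s : int), P j k = Some s -> s \in S,
      forall k : 'I_K, #|[set j : 'I_f | P j k == None]| = Z,
      forall s : int, s \in S ->
        exists (j : 'I_f) (k : 'I_K), P j k = Some s
    & forall (j1 j2 : 'I_f) (k1 k2 : 'I_K) (s : int),
        (j1, k1) <> (j2, k2) -> P j1 k1 = Some s -> P j2 k2 = Some s ->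
        P j1 k2 = None /\ P j2 k1 = None].
Arguments is_PDA : clear implicits.

Definition lift_block (n m : nat) (P : int -> pda_array n m) (x : option int) :
    pda_array n m :=
  if x is Some i then P i else const_mx None.

Lemma sum_const_ord (a b : nat) : (\sum_(i < a) b = a * b)%N.
Proof. by rewrite sum_nat_const card_ord. Qed.

(* The block (j, k) of [\mxblock] occupies rows j n, ..., j n + n - 1 and columns
   k m, ..., k m + m - 1; the cast only identifies the dimensions
   [\sum_(j < f) n] and [\sum_(k < K) m] with [f * n] and [K * m]. *)
Definition lift_array (K f n m : nat) (P : int -> pda_array n m)
    (Pb : pda_array f K) : pda_array (f * n) (K * m) :=
  castmx (sum_const_ord f n, sum_const_ord K m)
    (\mxblock_(j < f, k < K) lift_block P (Pb j k)).

(* Main.v *)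
Require Import Defs.
From mathcomp Require Import all_boot all_order all_algebra.
From mathcomp Require Import finmap.

(** Rows and columns of the lifted array are pairs (block index, inner index), and [lift_arrayE]
    reads the entry at such a pair off the corresponding block; each condition then splits into one
    on [Pb] and one on some [P i]. In a column, the Z star blocks give n stars each and the f - Z
    integer blocks give e each. For the Blackburn property, disjointness of the [S i] forces two
    equal integers to come from copies of the same [P i]: within one copy, C3 of [P i] applies; in
    different copies, C3 of [Pb] makes both crossing blocks all stars. *)

(** Built on [tagnat.Rank], the indexing behind [\mxblock], so that [mxblockK] yields
    [lift_arrayE]. *)
Definition block_ord {a b : nat} (i : 'I_a) (x : 'I_b) : 'I_(a * b) :=
  cast_ord (sum_const_ord a b) (tagnat.Rank (p_ := fun=> b) i x).

Lemma block_ord_inj {a b : nat} (i j : 'I_a) (x y : 'I_b) :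
  block_ord i x = block_ord j y -> i = j /\ x = y.
Proof.
move/cast_ord_inj/(congr1 val)/eqP; rewrite tagnat.eq_Rank.
by case/andP=> /eqP-> /eqP/val_inj->.
Qed.

Lemma block_ord_surj {a b : nat} (u : 'I_(a * b)) :
  exists (i : 'I_a) (x : 'I_b), u = block_ord i x.
Proof.
pose v := cast_ord (esym (sum_const_ord a b)) u.
exists (tagnat.sig1 v), (tagnat.sig2 v).
by rewrite /block_ord tagnat.sig2K cast_ordKV.
Qed.

Lemma block_ord_bij {a b : nat} :
  bijective (fun p : 'I_a * 'I_b => block_ord p.1 p.2).
Proof.
apply: inj_card_bij => [[i x] [j y] /block_ord_inj[/= -> ->] //|].
by rewrite card_prod !card_ord.
Qed.

Lemma lift_arrayE {K f n m : nat} (P : int -> pda_array n m)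
    (Pb : pda_array f K) j k x y :
  lift_array P Pb (block_ord j x) (block_ord k y) = lift_block P (Pb j k) x y.
Proof.
rewrite /lift_array castmxE !cast_ordK.
pose B (j : 'I_f) (k : 'I_K) := lift_block P (Pb j k).
by have /matrixP/(_ x y) := mxblockK B j k; rewrite mxE.
Qed.

(** Reindexing the rows along the bijection [block_ord] lets stars be counted block by block. *)
Lemma card_star_lift_column {K f n m : nat} (P : int -> pda_array n m)
    (Pb : pda_array f K) (k : 'I_K) (y : 'I_m) :
  #|[set u | lift_array P Pb u (block_ord k y) == None]| =
  (\sum_(j < f) #|[set x | lift_block P (Pb j k) x y == None]|)%N.
Proof.
rewrite -sum1dep_card.
rewrite (reindex (fun p : 'I_f * 'I_n => block_ord p.1 p.2)); last first.
  exact/onW_bij/block_ord_bij.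
under eq_bigl => p do rewrite lift_arrayE.
under [RHS]eq_bigr => j _ do rewrite -sum1dep_card.
by rewrite pair_big_dep.
Qed.

Theorem theorem7 (K f Z m n e : nat) (Sb : {fset int}) (Pb : pda_array f K)
    (S : int -> {fset int}) (P : int -> pda_array n m)
    (m_gt0 : (0 < m)%N) (n_gt0 : (0 < n)%N)
    (PbPDA : is_PDA K f Z Sb Pb)
    (PPDA : forall i : int, i \in Sb -> is_PDA m n e (S i) (P i))
    (S_disjoint : forall i j : int, i \in Sb -> j \in Sb -> i <> j ->
       [disjoint S i & S j]%fset) :
  is_PDA (K * m)%N (f * n)%N (Z * n + (f - Z) * e)%N
    (\bigcup_(i <- Sb) S i)%fset
    (lift_array P Pb).
Proof.
case: PbPDA => -[K_gt0 f_gt0] Pb_in Pb_star Pb_surj Pb_C3.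
(* Star blocks hold no integers, so an integer entry reveals a base symbol [i]; [s \in S i] is kept
   for the disjointness argument. *)
have lift_Some j k x y s : lift_block P (Pb j k) x y = Some s ->
    exists i, [/\ Pb j k = Some i, i \in Sb, P i x y = Some s & s \in S i].
  case Pjk: (Pb j k) => [i|] /=; last by rewrite mxE.
  have iSb := Pb_in _ _ _ Pjk; have [_ P_in _ _ _] := PPDA i iSb.
  by move=> Ps; exists i; split=> //; apply: P_in Ps.
split.
- by rewrite !muln_gt0 K_gt0 f_gt0 m_gt0 n_gt0.
- move=> u v s.
  have [j [x ->]] := block_ord_surj u; have [k [y ->]] := block_ord_surj v.
  rewrite lift_arrayE => /lift_Some[i [_ iSb _ sSi]].
  by apply/bigfcupP; exists i => //; rewrite iSb.
- move=> v; have [k [y ->]] := block_ord_surj v.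
  (* Star blocks and integer blocks of block column [k] give the summands [Z * n] and
     [(f - Z) * e]. *)
  rewrite card_star_lift_column (bigID (fun j => Pb j k == None)) /=.
  congr addn.
    rewrite (eq_bigr (fun=> n)) => [|j /eqP -> /=].
      by rewrite sum_nat_cond_const -(Pb_star k).
    rewrite -[RHS]card_ord -cardsT; apply: eq_card => x.
    by rewrite !inE mxE eqxx.
  rewrite (eq_bigr (fun=> e)) => [|j]; last first.
    case Pjk: (Pb j k) => [i|//] _ /=.
    by have [_ _ -> _ _] := PPDA i (Pb_in _ _ _ Pjk).
  rewrite sum_nat_cond_const; congr muln.
  (* The integer cells of column [k] of [Pb] are the complement of its Z stars among f rows. *)
  have := cardsC [set j | Pb j k == None].
  rewrite Pb_star card_ord => /(canRL (addKn _)) <-.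
  by apply: eq_card => j; rewrite !inE.
- move=> s /bigfcupP[i]; rewrite andbT => iSb sSi.
  have [j [k Pjk]] := Pb_surj i iSb.
  have [_ _ _ P_surj _] := PPDA i iSb; have [x [y Pxy]] := P_surj s sSi.
  by exists (block_ord j x), (block_ord k y); rewrite lift_arrayE Pjk.
move=> u1 u2 v1 v2 s.
have [j1 [x1 ->]] := block_ord_surj u1; have [k1 [y1 ->]] := block_ord_surj v1.
have [j2 [x2 ->]] := block_ord_surj u2; have [k2 [y2 ->]] := block_ord_surj v2.
rewrite !lift_arrayE => neq.
move=> /lift_Some[i [P1 iSb Pi1 sSi]] /lift_Some[i' [P2 i'Sb Pi2 sSi']].
(* Otherwise [s] would lie in two disjoint symbol sets. *)
have eqi : i' = i.
  apply/eqP/negPn/negP => /eqP ne.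
  by have /fdisjointP/(_ s sSi')/negP := S_disjoint i' i i'Sb iSb ne.
rewrite {}eqi in P2 Pi2 => {i' i'Sb sSi'}.
have [[ej ek]|nejk] := (j1, k1) =P (j2, k2).
  (* Same block: the inner positions must differ, as the full positions do. *)
  rewrite -ej -ek P1 /=; have [_ _ _ _ P_C3] := PPDA i iSb.
  apply: P_C3 Pi1 Pi2 => -[ex ey]; apply: neq.
  by rewrite ej ek ex ey.
(* Different blocks, both holding [i] in [Pb]: the crossing base cells are stars, hence so are their
   whole blocks. *)
by have [-> ->] := Pb_C3 _ _ _ _ _ nejk P1 P2; rewrite /= !mxE.
Qed.
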